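(* The following three statements hold. (1) For every interval graph $G$ on $n$ vertices, $G$ or its complement $\overline{G}$ contains the complete bipartite graph $K_{m,m}$ as a (not necessarily induced) subgraph, where $m=\lfloor n/4\rfloor$. (2) For every cograph $G$ on $n$ vertices, $G$ or $\overline{G}$ contains $K_{m,m}$ as a subgraph, where $m=\lfloor n/4\rfloor$. (3) For every chordal graph $G$ on $n$ vertices, $G$ or $\overline{G}$ contains $K_{m,m}$ as a subgraph, where $m=\lfloor 2n/9\rfloor$.
   Context: All graphs are finite and simple; $\overline{G}$ denotes the complement of $G$. An interval graph is the intersection graph of a finite family of intervals on the real line (vertices are the intervals, two adjacent iff they intersect). A cograph is a graph obtainable from a single vertex by repeatedly taking complements and disjoint unions; equivalently, a graph with no induced path on four vertices. A chordal graph is a graph with no induced cycle on four or more vertices; equivalently, the intersection graph of a finite family of subtrees of a tree. In the paper's language: these classes have the strong Erdős–Hajnal property with constants $1/4$, $1/4$, $2/9$ respectively. *)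

(* Defs.v *)
From mathcomp Require Import all_boot all_order all_algebra.
From mathcomp Require Import reals.

Set Implicit Arguments.
Unset Strict Implicit.
Unset Printing Implicit Defensive.

Record sgraph := SGraph {
  vertex :> finType;
  adj : rel vertex;
  adj_sym : symmetric adj;
  adj_irr : irreflexive adj }.

Definition compl_rel (G : sgraph) : rel G :=
  fun x y => (x != y) && ~~ adj x y.

Lemma compl_rel_sym (G : sgraph) : symmetric (@compl_rel G).
Proof. by move=> x y; rewrite /compl_rel eq_sym adj_sym. Qed.

Lemma compl_rel_irr (G : sgraph) : irreflexive (@compl_rel G).
Proof. by move=> x; rewrite /compl_rel eqxx. Qed.

Definition compl (G : sgraph) : sgraph :=
  SGraph (@compl_rel_sym G) (@compl_rel_irr G).

Definition dunion_rel (G H : sgraph) : rel (G + H)%type :=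
  fun u v => match u, v with
             | inl x, inl y => adj x y
             | inr x, inr y => adj x y
             | _, _ => false
             end.

Lemma dunion_rel_sym (G H : sgraph) : symmetric (@dunion_rel G H).
Proof. by move=> [x|x] [y|y] //=; rewrite adj_sym. Qed.

Lemma dunion_rel_irr (G H : sgraph) : irreflexive (@dunion_rel G H).
Proof. by move=> [x|x] /=; rewrite adj_irr. Qed.

Definition dunion (G H : sgraph) : sgraph :=
  SGraph (@dunion_rel_sym G H) (@dunion_rel_irr G H).

Definition bipartite_rel (m n : nat) : rel ('I_m + 'I_n)%type :=
  fun u v => match u, v with
             | inl _, inr _ | inr _, inl _ => true
             | _, _ => false
             end.

Lemma bipartite_rel_sym (m n : nat) : symmetric (@bipartite_rel m n).
Proof. by move=> [x|x] [y|y]. Qed.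

Lemma bipartite_rel_irr (m n : nat) : irreflexive (@bipartite_rel m n).
Proof. by move=> [x|x]. Qed.

Definition complete_bipartite (m n : nat) : sgraph :=
  SGraph (@bipartite_rel_sym m n) (@bipartite_rel_irr m n).

(* Not necessarily induced. *)
Definition contains_subgraph (G H : sgraph) : Prop :=
  exists f : H -> G,
    injective f /\ forall x y : H, adj x y -> adj (f x) (f y).

Definition isomorphic (G H : sgraph) : Prop :=
  exists f : G -> H,
    bijective f /\ forall x y : G, adj (f x) (f y) = adj x y.

(* Intervals may be open, closed, half-open, unbounded or empty (an empty
   interval only yields an isolated vertex), and distinct vertices may carry
   the same interval. *)
Definition interval_graph (R : realType) (G : sgraph) : Prop :=
  exists I : G -> interval R,
    forall x y : G,
      adj x y <-> x <> y /\ exists p : R, p \in I x /\ p \in I y.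

Inductive cograph : sgraph -> Prop :=
| cograph_single (G : sgraph) : #|G| = 1 -> cograph G
| cograph_compl (G : sgraph) : cograph G -> cograph (compl G)
| cograph_dunion (G H : sgraph) :
    cograph G -> cograph H -> cograph (dunion G H)
| cograph_iso (G H : sgraph) : isomorphic G H -> cograph G -> cograph H.

(* [ordS i] is the cyclic successor of [i] in ['I_k], so the right-hand side
   is adjacency in the cycle 0, 1, ..., k-1 when [3 <= k]. *)
Definition has_induced_cycle (G : sgraph) (k : nat) : Prop :=
  exists f : 'I_k -> G,
    injective f /\
    forall i j : 'I_k, adj (f i) (f j) = (j == ordS i) || (i == ordS j).

Definition chordal (G : sgraph) : Prop :=
  forall k : nat, 4 <= k -> ~ has_induced_cycle G k.

(* Main.v *)
(* Interval graphs: order the vertices by right endpoint and cut after the first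
   m of them; either m intervals lie entirely beyond the cut, or at least 2m
   intervals contain the cut point and form a clique.

   Cographs: descend the cotree along the larger child; the siblings met on the
   way are complete or anticomplete to the current subgraph, so one of the two
   kinds accumulates m vertices while the current subgraph still has m.

   Chordal graphs: suppose there is no pair of m-sets that is complete or
   anticomplete.  A clique K separates G into components of size at most m,
   which group into three parts W1, W2, W3 of size less than m, up to rounding,
   where |K| < 2m.  In each Wi find a clique Ri cutting off a set Xi of at least
   m/2 vertices whose components have at most about m/2 vertices.  As Xi and Xj
   together are anticomplete to all that avoids them, their cliques Ri and Rj
   are missed by few vertices of K, so that some Ri contains m vertices of K.
   These are complete to K and to Ri inside Wi, a set of fewer than 2m vertices,
   so Wi is mostly made of Xi and of what Ri separates from Xi; distributing
   the components of Xi among the two other parts then yields an anticomplete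
   pair. *)
Require Import Defs.
From mathcomp Require Import all_boot all_order all_algebra.
From mathcomp Require Import reals.
From mathcomp Require Import boolp zify.

Set Implicit Arguments.
Unset Strict Implicit.
Unset Printing Implicit Defensive.

Import Order.TTheory.

(** * Complete bipartite subgraphs from pairs of vertex sets *)

Lemma subset_of_card (T : finType) (A : {set T}) (m : nat) :
  m <= #|A| -> exists2 B : {set T}, B \subset A & #|B| = m.
Proof.
elim: m => [|m IHm] ltmA; first by exists set0; rewrite ?sub0set ?cards0.
have [B sBA cardB] := IHm (ltnW ltmA).
have /card_gt0P[x] : 0 < #|A :\: B|.
  by rewrite cardsD (setIidPr sBA) cardB subn_gt0.
rewrite inE => /andP[xNB xA]; exists (x |: B).
  by rewrite subUset sub1set xA.
by rewrite cardsU1 xNB cardB.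
Qed.

Lemma biclique_contains (G : sgraph) (A B : {set G}) (m : nat) :
  m <= #|A| -> m <= #|B| -> {in A & B, forall x y, adj x y} ->
  contains_subgraph G (complete_bipartite m m).
Proof.
move=> leA leB AB.
pose f (u : 'I_m + 'I_m) : G := match u with
  | inl i => enum_val (widen_ord leA i) | inr i => enum_val (widen_ord leB i) end.
have fA i : f (inl i) \in A by exact: enum_valP.
have fB i : f (inr i) \in B by exact: enum_valP.
exists f; split=> [[i|i] [j|j]|[i|i] [j|j]] //=; last 2 first.
- by move=> _; apply: AB; [exact: fA | exact: fB].
- by move=> _; rewrite adj_sym; apply: AB; [exact: fA | exact: fB].
- by move/enum_val_inj=> /(congr1 val) /= /val_inj ->.
- by move=> eq_ij; have:= AB _ _ (fA i) (fB j); rewrite /= eq_ij adj_irr.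
- by move=> eq_ij; have:= AB _ _ (fA j) (fB i); rewrite /= eq_ij adj_irr.
- by move/enum_val_inj=> /(congr1 val) /= /val_inj ->.
Qed.

(** Any [m] vertices of [D] pair with the rest of [T]; [D = T] is the case of a clique. *)
Lemma dominating_contains (G : sgraph) (D T : {set G}) (m : nat) :
  D \subset T -> m <= #|D| -> 2 * m <= #|T| ->
  {in D & T, forall x y, x != y -> adj x y} ->
  contains_subgraph G (complete_bipartite m m).
Proof.
move=> sDT leD leT DT; have [A sAD cardA] := subset_of_card leD.
apply: (@biclique_contains G A (T :\: A)); first by rewrite cardA.
  rewrite cardsD (setIidPr (subset_trans sAD sDT)); lia.
move=> x y xA; rewrite inE => /andP[yNA yT].
by apply: DT => //; [exact: (subsetP sAD) | apply: contraNneq yNA => <-].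
Qed.

Lemma compl_contains (G : sgraph) (A B : {set G}) (m : nat) :
  m <= #|A| -> m <= #|B| -> [disjoint A & B] ->
  {in A & B, forall x y, ~~ adj x y} ->
  contains_subgraph (compl G) (complete_bipartite m m).
Proof.
move=> leA leB dAB AB.
apply: (@biclique_contains (compl G) A B) => // x y xA yB.
rewrite /= /compl_rel AB // andbT; apply: contraTneq yB => <-.
by rewrite (disjointFr dAB xA).
Qed.

(** * Interval graphs *)

(** Greedy choice of a maximiser of [f] outside the current set replaces sorting. *)
Lemma top_set (T : finType) (f : T -> nat) (m : nat) : m <= #|T| ->
  exists2 A : {set T}, #|A| = m & forall x y, x \in A -> y \notin A -> f y <= f x.
Proof.
elim: m => [|m IHm] ltmT.
  by exists set0; rewrite ?cards0 // => x y; rewrite inE.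
have [A cardA topA] := IHm (ltnW ltmT).
have /card_gt0P[z0] : 0 < #|~: A| by have := cardsC A; lia.
rewrite inE => z0NA.
case: (@arg_maxnP _ z0 (fun z => z \notin A) f z0NA) => z zNA zmax.
exists (z |: A) => [|x y]; first by rewrite cardsU1 zNA cardA.
rewrite !inE negb_or => /predU1P[->|xA] /andP[_ yNA]; [exact: zmax | exact: topA].
Qed.

(** [lt] stands for lying entirely before. The first hypothesis is the Ferrers condition of interval
    orders: it makes the successor sets [S x] nested, so that their sizes rank the vertices by right
    endpoint. *)
Lemma ferrers_bipartite (G : sgraph) (lt : rel G) (m : nat) :
  (forall x y x' y', lt x y -> lt x' y' -> lt x y' || lt x' y) ->
  (forall x y, lt x y -> ~~ adj x y) ->
  (forall x y, x != y -> ~~ lt x y -> ~~ lt y x -> adj x y) ->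
  4 * m <= #|G| ->
  contains_subgraph G (complete_bipartite m m) \/
  contains_subgraph (compl G) (complete_bipartite m m).
Proof.
move=> ferrers ltNadj Nlt_adj le4m; pose S x := [set y | lt x y].
have nested x y : #|S x| <= #|S y| -> S x \subset S y.
  move=> leS; case: (boolP (S x \subset S y)) => // /subsetPn[u].
  rewrite !inE => xu Nyu.
  have sub : S y \proper S x.
    apply/properP; split; last by exists u; rewrite inE.
    apply/subsetP=> v; rewrite !inE => yv.
    by case/orP: (ferrers _ _ _ _ xu yv) => //; rewrite (negPf Nyu).
  by move: (proper_card sub); rewrite ltnNge leS.
case: m le4m => [|m] le4m.
  by left; apply: (@biclique_contains _ set0 set0) => // x y; rewrite inE.
have [A cardA topA] : exists2 A : {set G}, #|A| = m.+1 &
    forall x y, x \in A -> y \notin A -> #|S y| <= #|S x|.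
  by apply: top_set; lia.
have /card_gt0P[z0 z0A] : 0 < #|A| by rewrite cardA.
(* In the interval picture [z] ends last in [A]: its right end is the cut point and [S z] lies
   beyond it. *)
case: (@arg_minnP _ z0 (fun z => z \in A) (fun z => #|S z|) z0A) => z zA zmin.
have [leB|gtB] := leqP m.+1 #|S z :\: A|.
  right; apply: (@compl_contains _ A (S z :\: A)); rewrite ?cardA //.
    by rewrite disjoint_sym disjoints_subset; apply/subsetP=> x; rewrite !inE => /andP[].
  move=> x y xA; rewrite !inE => /andP[_ zy]; apply: ltNadj.
  by have /subsetP/(_ y) := nested _ _ (zmin _ xA); rewrite !inE; apply.
left; pose C := ~: (A :|: S z).
have leC : 2 * m.+1 <= #|C|.
  have := cardsC (A :|: S z); have := cardsUI A (S z); have := cardsID A (S z).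
  by rewrite setIC -/C; lia.
apply: (@dominating_contains _ C C) => //; first by lia.
(* A vertex outside [A] has all its successors in [S z], which [C] avoids. *)
have CN x y : x \in C -> y \in C -> ~~ lt x y.
  rewrite !inE !negb_or => /andP[xNA _] /andP[_]; apply: contra => xy.
  by have /subsetP/(_ y) := nested _ _ (topA _ _ zA xNA); rewrite !inE; apply.
by move=> x y xC yC xy; apply: Nlt_adj => //; apply: CN.
Qed.

(** Comparing points instead of endpoints treats all shapes of intervals alike; an empty interval
    precedes and follows every interval. *)
Lemma interval_bipartite (R : realType) (G : sgraph) (m : nat) :
  interval_graph R G -> 4 * m <= #|G| ->
  contains_subgraph G (complete_bipartite m m) \/
  contains_subgraph (compl G) (complete_bipartite m m).
Proof.
move=> [I adjI]; pose lt x y :=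
  `[< forall p q : R, p \in I x -> q \in I y -> (p < q)%O >].
have convex (J : interval R) (p q c : R) :
    p \in J -> q \in J -> (p <= c)%O -> (c <= q)%O -> c \in J.
  case: J => l r; rewrite !itv_boundlr => /andP[lp _] /andP[_ qr] pc cq.
  apply/andP; split; first by apply: le_trans lp _; rewrite bnd_simp.
  by apply: le_trans qr; rewrite bnd_simp.
have NltP x y : ~~ lt x y -> exists p q, [/\ p \in I x, q \in I y & (q <= p)%O].
  move/asboolPn/existsNP => [p /existsNP[q /not_implyP[pI /not_implyP[qI /negP]]]].
  by rewrite -leNgt => qp; exists p, q.
apply: (@ferrers_bipartite _ lt) =>
  [x y x' y' /asboolP xy /asboolP x'y'|x y /asboolP xy|x y neq].
- apply/orP; case: (boolP (lt x y')); first by left.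
  move/NltP => [p [q [px qy' qp]]]; right; apply/asboolP => p' q' p'x' q'y.
  by apply: lt_trans (x'y' _ _ p'x' qy') (le_lt_trans qp (xy _ _ px q'y)).
- by apply/negP=> /adjI[_ [p [px py]]]; have := xy _ _ px py; rewrite ltxx.
(* By convexity the larger of [p'] and [q] lies in both intervals. *)
- move=> /NltP[p [q [px qy qp]]] /NltP[q' [p' [q'y p'x p'q']]].
  apply/adjI; split; first exact/eqP.
  have [p'q|/ltW qp'] := leP p' q.
    by exists q; split=> //; apply: (convex _ p' p).
  by exists p'; split=> //; apply: (convex _ q q').
Qed.

(** * Cographs *)

(** One step down the cotree: [f] embeds the larger child [G], and its sibling [Z], being
    anticomplete to it, is charged to [q]. An empty [Z] covers isomorphisms. *)
Lemma cograph_extend (G D : sgraph) (f : G -> D) (Z : {set D}) (m : nat) :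
  injective f -> (forall x y, adj (f x) (f y) = adj x y) ->
  (forall x z, z \in Z -> f x != z /\ ~~ adj (f x) z) ->
  #|D| = #|G| + #|Z| -> #|Z| <= #|G| ->
  (forall p q, p < m -> q < m -> 4 * m <= #|G| + p + q ->
    exists2 S : {set G}, m <= #|S| & exists T : {set G},
      (m <= #|T| + p /\ {in S & T, forall x y, adj x y}) \/
      (m <= #|T| + q /\ {in S & T, forall x y, @adj (compl G) x y})) ->
  forall p q, p < m -> q < m -> 4 * m <= #|D| + p + q ->
    exists2 S : {set D}, m <= #|S| & exists T : {set D},
      (m <= #|T| + p /\ {in S & T, forall x y, adj x y}) \/
      (m <= #|T| + q /\ {in S & T, forall x y, @adj (compl D) x y}).
Proof.
move=> inj_f adj_f fZ cardD leZ IH p q ltp ltq le4.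
(* As [p] and [q] are below [m], [D] has more than [2 * m] vertices and [G] at least [m]; once
   [q + #|Z|] reaches [m], the image of [G] and [Z] form the pair. *)
have [ltqZ|geqZ] := ltnP (q + #|Z|) m; last first.
  exists [set f x | x in [set: G]]; first by rewrite card_imset // cardsT; lia.
  exists Z; right; split; first by lia.
  by move=> _ z /imsetP[x _ ->] zZ; rewrite /= /compl_rel; have [-> ->] := fZ x z zZ.
have [|S leS [T [[leT ST]|[leT ST]]]] := IH p (q + #|Z|) ltp ltqZ; first by lia.
- exists (f @: S); first by rewrite card_imset.
  exists (f @: T); left; split; first by rewrite card_imset.
  by move=> _ _ /imsetP[x xS ->] /imsetP[y yT ->]; rewrite adj_f ST.
exists (f @: S); first by rewrite card_imset.
exists (f @: T :|: Z); right; split.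
  have /eqP : f @: T :&: Z == set0.
    apply/eqP/setP=> z; rewrite !inE; apply/negP=> /andP[/imsetP[x _ ->] /(fZ x)[]].
    by rewrite eqxx.
  by move=> dis; have := cardsUI (f @: T) Z; rewrite dis cards0 card_imset //; lia.
move=> _ z /imsetP[x xS ->]; rewrite inE => /orP[/imsetP[y yT ->]|zZ].
  by have := ST _ _ xS yT; rewrite /= /compl_rel adj_f (inj_eq inj_f).
by rewrite /= /compl_rel; have [-> ->] := fZ x z zZ.
Qed.

(* [p] and [q] count the vertices, outside [G], that are already known to be
   complete, resp. anticomplete, to [G]. *)
Lemma cograph_sets (G : sgraph) (m : nat) : cograph G ->
  forall p q, p < m -> q < m -> 4 * m <= #|G| + p + q ->
    exists2 S : {set G}, m <= #|S| & exists T : {set G},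
      (m <= #|T| + p /\ {in S & T, forall x y, adj x y}) \/
      (m <= #|T| + q /\ {in S & T, forall x y, @adj (compl G) x y}).
Proof.
elim=> {G} [G card1 p q|G _ IH p q ltp ltq|G H _ IHG _ IHH|G H [f [bij_f adj_f]] _ IH].
- by rewrite card1; lia.
- rewrite -addnA [p + q]addnC addnA => le4.
  have [S leS [T [[leT ST]|[leT ST]]]] := IH q p ltq ltp le4;
    exists S => //; exists T; [right|left]; split=> // x y xS yT.
  have xy := ST x y xS yT; rewrite /= /compl_rel /= /compl_rel xy andbF /= andbT.
  by apply: contraTneq xy => ->; rewrite adj_irr.
- have card_inl : #|[set @inl G H x | x in [set: G]]| = #|G|.
    by rewrite card_imset ?cardsT // => x y [].
  have card_inr : #|[set @inr G H x | x in [set: H]]| = #|H|.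
    by rewrite card_imset ?cardsT // => x y [].
  have [leHG|/ltnW leGH] := leqP #|H| #|G|.
    apply: (@cograph_extend G (dunion G H) inl [set inr x | x in [set: H]]) => //.
    + by move=> x y [].
    + by move=> x _ /imsetP[y _ ->].
    + by rewrite card_inr /= card_sum.
    + by rewrite card_inr.
  apply: (@cograph_extend H (dunion G H) inr [set inl x | x in [set: G]]) => //.
  + by move=> x y [].
  + by move=> x _ /imsetP[y _ ->].
  + by rewrite card_inl /= card_sum addnC.
  + by rewrite card_inl.
apply: (@cograph_extend G H f set0) => //; first exact: bij_inj.
- by move=> x z; rewrite inE.
- by rewrite cards0 addn0 (bij_eq_card bij_f).
- by rewrite cards0.
Qed.

Lemma cograph_bipartite (G : sgraph) (m : nat) : cograph G -> 4 * m <= #|G| ->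
  contains_subgraph G (complete_bipartite m m) \/
  contains_subgraph (compl G) (complete_bipartite m m).
Proof.
case: m => [|m] cG le4.
  by left; apply: (@biclique_contains _ set0 set0) => // x y; rewrite inE.
have [||| S leS [T]] := @cograph_sets G m.+1 cG 0 0 => //; first by rewrite !addn0.
rewrite !addn0; case=> -[leT ST]; [left|right].
  exact: biclique_contains ST.
exact: (@biclique_contains (compl G) S T).
Qed.

(** * Clique separators of chordal graphs *)

(** [c] is unconstrained beyond index [k], which lets walks be shifted and spliced freely; vertices
    may repeat. *)
Definition walk (G : sgraph) (c : nat -> G) (k : nat) : Prop :=
  forall i, i < k -> adj (c i) (c i.+1).

(** The induced path [c 0, ..., c k] is closed through [z] at position [k + 1] and [y] at [k + 2];
    [0 < k] makes the length at least 4. *)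
Lemma hole_cycle (G : sgraph) (c : nat -> G) (k : nat) (y z : G) :
  0 < k -> adj y z ->
  (forall i, i <= k -> c i != y /\ c i != z) ->
  (forall i, i <= k -> adj (c i) y = (i == 0)) ->
  (forall i, i <= k -> adj (c i) z = (i == k)) ->
  (forall i j, i < j <= k -> c i != c j) ->
  (forall i j, i < j <= k -> adj (c i) (c j) = (j == i.+1)) ->
  has_induced_cycle G k.+3.
Proof.
move=> k_gt0 yz cN cy cz c_inj c_adj.
pose g t := if t <= k then c t else if t == k.+1 then z else y.
have zNy : z != y by apply: contraTneq yz => ->; rewrite adj_irr.
have g_lt i j : i < j < k.+3 -> g i != g j /\
    adj (g i) (g j) = (j == i.+1) || ((i == 0) && (j == k.+2)).
  move=> /andP[ltij ltj]; rewrite /g.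
  have [lejk|gtjk] := leqP j k.
    have -> : i <= k by lia.
    by rewrite c_inj ?c_adj ?ltij //; split=> //; lia.
  have [leik|gtik] := leqP i k.
    have [cNy cNz] := cN i leik.
    have [ej|Nej] := eqVneq j k.+1; first by rewrite cz //; split=> //; lia.
    by rewrite cy //; split=> //; lia.
  have [-> ->] : i = k.+1 /\ j = k.+2 by lia.
  have -> : (k.+2 == k.+1) = false by lia.
  by rewrite !eqxx adj_sym yz.
exists (fun i : 'I_k.+3 => g i); split=> [i j eq_g|i j].
  apply/val_inj => /=; have [ltij|ltji|//] := ltngtP i j.
    by have [] := g_lt i j; rewrite ?ltij ?ltn_ord // eq_g eqxx.
  by have [] := g_lt j i; rewrite ?ltji ?ltn_ord // eq_g eqxx.
have ordSE (u : 'I_k.+3) : val (ordS u) = if u == k.+2 :> nat then 0 else u.+1.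
  rewrite /=; have [->|Nu] := eqVneq (nat_of_ord u) k.+2; first by rewrite modnn.
  by rewrite modn_small //; have := ltn_ord u; lia.
rewrite -!val_eqE !ordSE /=.
have := ltn_ord i; have := ltn_ord j.
move: g_lt (adj_irr (g i)); rewrite -/(nat_of_ord i) -/(nat_of_ord j).
move: (nat_of_ord i) (nat_of_ord j) => {ordSE} {}i {}j g_lt irr ltj lti.
have [ltij|ltji|<-] := ltngtP i j.
- have Hij : i < j < k.+3 by rewrite ltij.
  have [_ ->] := g_lt _ _ Hij.
  by case: (eqVneq i k.+2) => ?; case: (eqVneq j k.+2) => ?; lia.
- have Hji : j < i < k.+3 by rewrite ltji.
  have [_] := g_lt _ _ Hji; rewrite adj_sym => ->.
  by case: (eqVneq i k.+2) => ?; case: (eqVneq j k.+2) => ?; lia.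
- by rewrite irr; case: (eqVneq i k.+2) => ?; lia.
Qed.

(** Strong induction on the length: a later neighbour of [y], an earlier neighbour of [z], a
    repetition or a chord yields a shorter walk. A walk with none of these is a single vertex or
    closes through [z] and [y] to a hole. *)
Lemma chordal_common_neighbor (G : sgraph) (y z : G) : chordal G -> adj y z ->
  forall k (c : nat -> G), walk c k ->
  (forall i, i <= k -> c i != y /\ c i != z) ->
  adj (c 0) y -> adj (c k) z ->
  exists2 i, i <= k & adj (c i) y && adj (c i) z.
Proof.
move=> chG yz; elim/ltn_ind=> k IHk c wc cN c0y ckz.
case: (pselect (exists i, [/\ 0 < i, i <= k & adj (c i) y])) => [[i [i0 lei ciy]]|Ny].
  have [| | | | |j lej Hj] := IHk (k - i) _ (fun t => c (t + i)) => //; first by lia.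
  - by move=> t lt; rewrite addSn; apply: wc; lia.
  - by move=> t lt; apply: cN; lia.
  - by rewrite subnK.
  - by exists (j + i) => //; lia.
case: (pselect (exists i, i < k /\ adj (c i) z)) => [[i [lei ciz]]|Nz].
  have [| | | | |j lej Hj] := IHk i _ c => //.
  - by move=> t lt; apply: wc; lia.
  - by move=> t lt; apply: cN; lia.
  - by exists j => //; lia.
(* Skips [d] indices after [i]: a repetition skips [c j] too, whereas a chord keeps both its
   ends. *)
have shortcut i j d : i < j -> j <= k -> 0 < d ->
    (c i = c j /\ d = j - i) \/ (adj (c i) (c j) /\ d = j - i.+1) ->
    exists2 i, i <= k & adj (c i) y && adj (c i) z.
  move=> ltij lejk d0 Hd.
  have [| | | | |t let_ Ht] :=
    IHk (k - d) _ (fun t => if t <= i then c t else c (t + d)) => //.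
  - by lia.
  - move=> t lt; have [lti|ltit|eti] := ltngtP t i.
    + by apply: wc; lia.
    + by rewrite addSn; apply: wc; lia.
    + rewrite eti; case: Hd => -[ci ed].
        by rewrite ci (_ : i.+1 + d = j.+1); [apply: wc | ]; lia.
      by rewrite (_ : i.+1 + d = j) //; lia.
  - by move=> t lt /=; case: ifP => ti; apply: cN; lia.
  - case: ifP => ti; last by rewrite subnK //; lia.
    case: Hd => -[ci ed]; last by lia.
    rewrite (_ : k - d = i); last by lia.
    by rewrite ci (_ : j = k) //; lia.
  - by move: Ht => /=; case: ifP => ti Ht; [exists t | exists (t + d)] => //; lia.
case: (pselect (exists i j, [/\ i < j, j <= k & c i = c j])) =>
  [[i [j [ltij lej cij]]]|Ninj].
  by apply: (shortcut i j (j - i)) => //; [lia | left].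
case: (pselect (exists i j, [/\ i.+1 < j, j <= k & adj (c i) (c j)])).
  move=> [i [j [ltij lej cij]]].
  by apply: (shortcut i j (j - i.+1)) => //; [lia | lia | right].
move=> Nadj; case: k => [|k] in IHk wc cN ckz Ny Nz shortcut Ninj Nadj *.
  by exists 0; rewrite // c0y.
case: (chG k.+4) => //; apply: (@hole_cycle _ c k.+1 y z) => //.
- move=> i lei; have [->|i0] := posnP i; first by rewrite c0y.
  by apply/negbTE/negP=> ciy; apply: Ny; exists i.
- move=> i lei; have [->|Ni] := eqVneq i k.+1; first by rewrite ckz.
  by apply/negbTE/negP=> ciz; apply: Nz; exists i; split=> //; lia.
- by move=> i j /andP[ltij lej]; apply/eqP=> cij; apply: Ninj; exists i, j.
- move=> i j /andP[ltij lej]; have [->|Nj] := eqVneq j i.+1; first by apply: wc; lia.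
  by apply/negbTE/negP=> cij; apply: Nadj; exists i, j; split=> //; lia.
Qed.

(** * Anticomplete sets and connected components *)

Definition anticomplete (G : sgraph) (A B : {set G}) : bool :=
  [forall x in A, forall y in B, ~~ adj x y].

Lemma anticompleteP (G : sgraph) (A B : {set G}) :
  reflect {in A & B, forall x y, ~~ adj x y} (anticomplete A B).
Proof.
apply: (iffP forall_inP) => [H x y xA yB|H x xA].
  exact: (forall_inP (H x xA)).
by apply/forall_inP=> y; apply: H.
Qed.

Definition clique (G : sgraph) (K : {set G}) : Prop :=
  {in K &, forall x y, x != y -> adj x y}.

(* A union of connected components of the subgraph induced by [S]. *)
Definition component_union (G : sgraph) (A S : {set G}) : bool :=
  (A \subset S) && anticomplete A (S :\: A).

(** A path-free form, under which the empty set is connected; [connected_walk] recovers walks. *)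
Definition connected (G : sgraph) (X : {set G}) : Prop :=
  forall A, component_union A X -> A = set0 \/ A = X.

Definition components_le (G : sgraph) (S : {set G}) (a : nat) : Prop :=
  forall C, component_union C S -> connected C -> #|C| <= a.

Lemma component_union_refl (G : sgraph) (S : {set G}) : component_union S S.
Proof.
by rewrite /component_union subxx; apply/anticompleteP=> x y; rewrite setDv inE.
Qed.

Lemma component_union_trans (G : sgraph) (A B S : {set G}) :
  component_union A B -> component_union B S -> component_union A S.
Proof.
move=> /andP[sAB /anticompleteP AB] /andP[sBS /anticompleteP BS].
rewrite /component_union (subset_trans sAB sBS); apply/anticompleteP=> x y xA.
rewrite inE => /andP[yNA yS]; have [yB|yNB] := boolP (y \in B).
  by apply: AB; rewrite // inE yNA.
by apply: BS; rewrite ?inE ?yNB // (subsetP sAB).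
Qed.

Lemma component_unionD (G : sgraph) (A B S : {set G}) :
  component_union A S -> component_union B S -> component_union (A :\: B) S.
Proof.
move=> /andP[sAS /anticompleteP AS] /andP[sBS /anticompleteP BS].
rewrite /component_union (subset_trans (subsetDl _ _) sAS).
apply/anticompleteP=> x y; rewrite !inE => /andP[xNB xA] /andP[+ yS].
rewrite negb_and negbK => /orP[yB|yNA].
  by rewrite adj_sym BS // inE xNB (subsetP sAS).
by rewrite AS // inE yNA.
Qed.

Lemma component_exists (G : sgraph) (A S : {set G}) :
  component_union A S -> A != set0 ->
  exists C : {set G}, [/\ C \subset A, C != set0, component_union C S & connected C].
Proof.
move=> AS A0; pose P (C : {set G}) := [&& C \subset A, C != set0 & component_union C S].
have PA : P A by rewrite /P subxx A0.
case: (@arg_minnP _ A P (fun C : {set G} => #|C|) PA) => C /and3P[sCA C0 CS] Cmin.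
exists C; split=> // B BC; case: (eqVneq B set0) => [|B0]; [by left|right].
have /andP[sBC _] := BC; apply/eqP; rewrite eqEcard sBC Cmin // /P B0.
by rewrite (subset_trans sBC sCA) (component_union_trans BC CS).
Qed.

(** [A] is a smallest union of components reaching [e], so removing a component [C] falls below [e];
    hence [A] overshoots [e] by less than [a]. *)
Lemma component_grouping (G : sgraph) (S : {set G}) (a e : nat) :
  components_le S a -> 0 < e <= #|S| ->
  exists A C : {set G}, [/\ component_union A S, component_union C S & C \subset A] /\
    [/\ e <= #|A|, #|A :\: C| < e & #|C| <= a].
Proof.
move=> leSa /andP[e0 leeS].
pose P (A : {set G}) := component_union A S && (e <= #|A|).
have PS : P S by rewrite /P component_union_refl.
case: (@arg_minnP _ S P (fun C : {set G} => #|C|) PS) => A /andP[AS leeA] Amin.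
have A0 : A != set0 by rewrite -card_gt0; lia.
have [C [sCA C0 CS connC]] := component_exists AS A0.
exists A, C; split; split=> //; last exact: leSa.
rewrite ltnNge; apply/negP=> leAC.
have := Amin (A :\: C); rewrite /P component_unionD // leAC => /(_ isT).
by rewrite cardsD (setIidPr sCA) -card_gt0 in C0 *; have := subset_leq_card sCA; lia.
Qed.

(** The vertices reached from [v] inside [X] form a nonempty union of components of [X]. *)
Lemma connected_walk (G : sgraph) (X : {set G}) (v x : G) :
  connected X -> v \in X -> x \in X ->
  exists c k, [/\ walk c k, c 0 = v, c k = x & forall i, i <= k -> c i \in X].
Proof.
move=> connX vX xX.
pose A := [set x | `[< exists c k, [/\ walk c k, c 0 = v, c k = x &
  forall i, i <= k -> c i \in X] >]].
have vA : v \in A.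
  by rewrite inE; apply/asboolP; exists (fun=> v), 0; split.
have AX : component_union A X.
  apply/andP; split.
    apply/subsetP=> u; rewrite inE => /asboolP[c [k [_ _ <- cX]]]; exact: cX.
  apply/anticompleteP=> u w uA; rewrite inE => /andP[+ wX]; apply: contra => uw.
  move: uA; rewrite !inE => /asboolP[c [k [wc c0 ck cX]]]; apply/asboolP.
  exists (fun t => if t <= k then c t else w), k.+1; split=> //.
  - move=> i ltik; have [ltk|ltk|->] := ltngtP i k; first exact: wc.
      by lia.
    by rewrite ck.
  - by rewrite ltnn.
  - by move=> i _; case: ifP => // /cX.
case: (connX A AX) => eA; first by rewrite eA inE in vA.
have : x \in A by rewrite eA.
by rewrite inE => /asboolP.
Qed.

(** A vertex [v] with most neighbours in [Q] works. If it missed [z], let [c l] be the first vertex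
    adjacent to [z] on a walk in [X] from [v]. For each neighbour [y] of [v] in [Q], the common
    neighbour of [y] and [z] up to [c l] is [c l] itself, which thus beats [v]. *)
Lemma chordal_dominating (G : sgraph) (X Q : {set G}) :
  chordal G -> connected X -> X != set0 -> clique Q -> [disjoint X & Q] ->
  (forall q, q \in Q -> exists2 x, x \in X & adj x q) ->
  exists2 v, v \in X & {in Q, forall q, adj v q}.
Proof.
move=> chG connX /set0Pn[v0 v0X] clQ dXQ QX.
pose nb v := [set q in Q | adj v q].
case: (@arg_maxnP _ v0 (fun v => v \in X) (fun v => #|nb v|) v0X) => v vX vmax.
exists v => // z zQ; apply: contraT => Nvz.
have [x xX xz] := QX z zQ.
have [c [k [wc c0 ck cX]]] := connected_walk connX vX xX.
have exk : exists i, (i <= k) && adj (c i) z by exists k; rewrite leqnn ck.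
case: (ex_minnP exk) => l /andP[lek clz] lmin.
suff lt : #|nb v| < #|nb (c l)| by have := leq_trans lt (vmax _ (cX l lek)); rewrite ltnn.
apply/proper_card/properP; split; last first.
  by exists z; rewrite inE ?zQ // (negPf Nvz).
apply/subsetP=> y; rewrite !inE => /andP[yQ vy]; rewrite yQ /=.
have yz : adj y z.
  by apply: clQ => //; apply: contraNneq Nvz => <-.
have cN q i : q \in Q -> i <= l -> c i != q.
  move=> qQ lei; apply: contraTneq qQ => <-.
  by rewrite (disjointFr dXQ) // cX // (leq_trans lei).
have [| | | |i lei /andP[ciy ciz]] := @chordal_common_neighbor _ y z chG yz l c => //.
- by move=> i lei; apply/wc/(leq_trans lei).
- by move=> i lei; split; apply: cN.
- by rewrite c0.
suff <- : i = l by [].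
by apply/eqP; rewrite eqn_leq lei lmin // ciz (leq_trans lei).
Qed.

(** Descent along a tree decomposition: while a component [C] of [S] exceeds [a], a vertex [v] of
    [C] dominating the neighbours of [C] in [Q] joins them in the new clique, and [S] shrinks to
    [C :\ v], still of size at least [a]. *)
Lemma clique_separator (G : sgraph) (S Q : {set G}) (a : nat) :
  chordal G -> clique Q -> [disjoint S & Q] ->
  anticomplete S (~: (S :|: Q)) -> a <= #|S| ->
  exists X R : {set G}, [/\ X \subset S, R \subset S :|: Q & [disjoint X & R]] /\
    [/\ clique R, anticomplete X (~: (X :|: R)), a <= #|X| & components_le X a].
Proof.
move=> chG; have [n] := ubnP #|S|.
elim: n => // n IHn in S Q * => ltSn clQ dSQ /anticompleteP SQ leS.
case: (pselect (components_le S a)) => [leSa|].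
  exists S, Q; rewrite subxx subsetUr dSQ; split; split=> //; exact/anticompleteP.
move/existsNP=> [C /not_implyP[CS /not_implyP[connC /negP]]]; rewrite -ltnNge => ltaC.
have /andP[sCS /anticompleteP CSD] := CS.
pose Q1 := [set q in Q | [exists x in C, adj x q]].
have sQ1 : Q1 \subset Q by apply/subsetP=> q; rewrite inE => /andP[].
have dCQ : [disjoint C & Q] by apply: disjointWl dSQ.
have [|||| v vC vQ] := @chordal_dominating G C Q1 chG connC.
- by rewrite -card_gt0; lia.
- by move=> x y /(subsetP sQ1) xQ /(subsetP sQ1) yQ; apply: clQ.
- by apply: disjointWr dCQ.
- by move=> q; rewrite inE => /andP[_ /exists_inP[x xC xq]]; exists x.
have vNQ : v \notin Q by rewrite (disjointFr dCQ vC).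
have cardC := cardsD1 v C; rewrite vC in cardC.
have [| | | | |X [R [[sX sR dXR] HXR]]] := IHn (C :\ v) (v |: Q1).
- by have := subset_leq_card sCS; lia.
- move=> x y; rewrite !in_setU1 => /predU1P[->|xQ] /predU1P[->|yQ]; rewrite ?eqxx //.
  + by rewrite vQ.
  + by rewrite adj_sym vQ.
  by apply: clQ; apply: (subsetP sQ1).
- rewrite disjoint_subset; apply/subsetP=> x; rewrite !inE => /andP[xv xC].
  by rewrite (negPf xv) (disjointFr dCQ xC).
- apply/anticompleteP=> x y; rewrite in_setD1 => /andP[xv xC].
  rewrite in_setC in_setU in_setD1 in_setU1 !negb_or negb_and negbK.
  move=> /andP[yC /andP[yv yQ1]]; rewrite (negPf yv) /= in yC.
  have [yS|yNS] := boolP (y \in S); first by rewrite CSD // inE yC.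
  have [yQ|yNQ] := boolP (y \in Q).
    by apply: contra yQ1 => xy; rewrite inE yQ; apply/exists_inP; exists x.
  by rewrite SQ ?(subsetP sCS) // !inE negb_or yNS.
- by lia.
exists X, R; split=> //; split=> //.
  exact: subset_trans sX (subset_trans (subsetDl _ _) sCS).
apply: subset_trans sR _; apply/subsetP=> x; rewrite !inE.
case/or3P=> [/andP[_ /(subsetP sCS)->]//|/eqP->|/andP[-> _]]; last by rewrite orbT.
by rewrite (subsetP sCS).
Qed.

(** * Counting in chordal graphs *)

(** Shaped after [dominating_contains], the form in which complete pairs arise below. *)
Definition no_biclique (G : sgraph) (m : nat) : Prop :=
  forall D T : {set G}, D \subset T -> {in D & T, forall x y, x != y -> adj x y} ->
  m <= #|D| -> #|T| < 2 * m.

Definition no_antibiclique (G : sgraph) (m : nat) : Prop :=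
  forall A B : {set G}, [disjoint A & B] -> anticomplete A B ->
  m <= #|A| -> #|B| < m.

Lemma anticomplete_sym (G : sgraph) (A B : {set G}) :
  anticomplete A B -> anticomplete B A.
Proof.
by move/anticompleteP=> AB; apply/anticompleteP=> x y xB yA; rewrite adj_sym AB.
Qed.

Lemma anticompleteS (G : sgraph) (A A' B B' : {set G}) :
  A' \subset A -> B' \subset B -> anticomplete A B -> anticomplete A' B'.
Proof.
move=> /subsetP sA /subsetP sB /anticompleteP AB.
by apply/anticompleteP=> x y /sA xA /sB; apply: AB.
Qed.

Lemma anticompleteUl (G : sgraph) (A B C : {set G}) :
  anticomplete A C -> anticomplete B C -> anticomplete (A :|: B) C.
Proof.
move=> /anticompleteP AC /anticompleteP BC; apply/anticompleteP=> x y.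
by rewrite inE => /orP[xA|xB]; [apply: AC | apply: BC].
Qed.

Lemma anticompleteUr (G : sgraph) (A B C : {set G}) :
  anticomplete A B -> anticomplete A C -> anticomplete A (B :|: C).
Proof.
by move=> /anticomplete_sym BA /anticomplete_sym CA;
  apply/anticomplete_sym/anticompleteUl.
Qed.

Lemma disjoint_setUl (T : finType) (A B C : {set T}) :
  [disjoint A & C] -> [disjoint B & C] -> [disjoint A :|: B & C].
Proof. by rewrite -!setI_eq0 setIUl => /eqP-> /eqP->; rewrite setU0. Qed.

Lemma cardsU_disjoint (T : finType) (A B : {set T}) :
  [disjoint A & B] -> #|A :|: B| = #|A| + #|B|.
Proof. by move=> dAB; apply/eqP; rewrite (leq_card_setU A B). Qed.

(* A vertex of [K] lies in two of the [Ri], or in one of them while avoiding the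
   other two, or it avoids all three pairs. *)
Lemma double_count (T : finType) (K R1 R2 R3 : {set T}) :
  2 * #|K| <= #|K :&: R1| + #|K :&: R2| + #|K :&: R3| +
    (#|K :\: (R1 :|: R2)| + #|K :\: (R1 :|: R3)| + #|K :\: (R2 :|: R3)|).
Proof.
have cardE (A : {set T}) (P : pred T) : A =i [pred x in K | P x] ->
    #|A| = \sum_(x in K) (P x : nat).
  move=> eqA; rewrite (eq_card eqA) -sum1_card [RHS]big_mkcond [LHS]big_mkcond /=.
  by apply: eq_bigr => x _; rewrite !inE; case: (x \in K); case: (P x).
rewrite (@cardE (K :&: R1) (mem R1)) => [|x]; last by rewrite !inE.
rewrite (@cardE (K :&: R2) (mem R2)) => [|x]; last by rewrite !inE.
rewrite (@cardE (K :&: R3) (mem R3)) => [|x]; last by rewrite !inE.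
rewrite (@cardE (K :\: (R1 :|: R2)) (mem (~: (R1 :|: R2)))) => [|x];
  last by rewrite !inE andbC.
rewrite (@cardE (K :\: (R1 :|: R3)) (mem (~: (R1 :|: R3)))) => [|x];
  last by rewrite !inE andbC.
rewrite (@cardE (K :\: (R2 :|: R3)) (mem (~: (R2 :|: R3)))) => [|x];
  last by rewrite !inE andbC.
rewrite -sum1_card big_distrr -!big_split /=; apply: leq_sum => x _.
by rewrite !inE; case: (x \in R1); case: (x \in R2); case: (x \in R3).
Qed.

(* Geometrically, [K] is a bag of a tree decomposition, [W] collects some of
   the branches hanging from [K], and [R] is the bag of a node of [W] beyond
   which lies [X]. *)
Definition cutoff (G : sgraph) (K W X R : {set G}) : Prop :=
  [/\ X \subset W, R \subset W :|: K, [disjoint X & R], clique R &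
      anticomplete X (~: (X :|: R))].

(** [X1 :|: X2] has at least [m] vertices and is anticomplete to all that avoids both [Xi] and both
    [Ri]; the four sets counted are disjoint parts of this remainder. *)
Lemma card_beyond_two (G : sgraph) (m : nat) (K W1 W2 W3 X1 R1 X2 R2 : {set G}) :
  no_antibiclique G m ->
  [disjoint K & W1] -> [disjoint K & W2] -> [disjoint K & W3] ->
  [disjoint W1 & W2] -> [disjoint W1 & W3] -> [disjoint W2 & W3] ->
  cutoff K W1 X1 R1 -> cutoff K W2 X2 R2 -> m <= #|X1| + #|X2| ->
  #|W3| + #|W1 :\: (X1 :|: R1)| + #|W2 :\: (X2 :|: R2)| + #|K :\: (R1 :|: R2)| < m.
Proof.
move=> noA dK1 dK2 dK3 d12 d13 d23 [sX1 sR1 _ _ aX1] [sX2 sR2 _ _ aX2] leX.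
have dX : [disjoint X1 & X2] by apply: disjointW d12.
pose B := ~: (X1 :|: X2 :|: R1 :|: R2).
have ltB : #|B| < m.
  apply: (noA (X1 :|: X2)); last by rewrite cardsU_disjoint.
    rewrite disjoints_subset; apply/subsetP=> x; rewrite !inE.
    by case/orP=> ->; rewrite ?orbT.
  apply: anticompleteUl.
    apply: anticompleteS aX1 => //; apply/subsetP=> x; rewrite !inE !negb_or.
    by case/andP=> /andP[/andP[-> _] ->].
  apply: anticompleteS aX2 => //; apply/subsetP=> x; rewrite !inE !negb_or.
  by case/andP=> /andP[/andP[_ ->] _] ->.
apply: leq_ltn_trans ltB.
rewrite -!cardsU_disjoint.
- apply/subset_leq_card/subsetP=> x; rewrite !inE.
  have := subsetP sX1 x; have := subsetP sX2 x.
  have := subsetP sR1 x; have := subsetP sR2 x; rewrite !inE.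
  have /setP/(_ x) := disjoint_setI0 dK1; have /setP/(_ x) := disjoint_setI0 dK2.
  have /setP/(_ x) := disjoint_setI0 dK3; have /setP/(_ x) := disjoint_setI0 d12.
  have /setP/(_ x) := disjoint_setI0 d13; have /setP/(_ x) := disjoint_setI0 d23.
  rewrite !inE.
  case: (x \in K); case: (x \in W1); case: (x \in W2); case: (x \in W3) => //=;
    case: (x \in X1); case: (x \in X2); case: (x \in R1); case: (x \in R2) => //=;
    by intuition.
- rewrite -setI_eq0; apply/eqP/setP=> x; rewrite !inE.
  have /setP/(_ x) := disjoint_setI0 dK1; have /setP/(_ x) := disjoint_setI0 dK2.
  have /setP/(_ x) := disjoint_setI0 dK3; rewrite !inE.
  by case: (x \in K); case: (x \in W1); case: (x \in W2); case: (x \in W3) => //=;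
    rewrite ?andbF.
- rewrite -setI_eq0; apply/eqP/setP=> x; rewrite !inE.
  have /setP/(_ x) := disjoint_setI0 d12; have /setP/(_ x) := disjoint_setI0 d23.
  by rewrite !inE; case: (x \in W1); case: (x \in W2); case: (x \in W3) => //=;
    rewrite ?andbF.
- by rewrite disjoint_sym; apply: disjointWl d13; apply: subsetDl.
Qed.

(** If [K :&: R] had [m] vertices, then [K] and [R :&: W1], to which it is complete, would total
    fewer than [2 * m]. This makes [X] large enough to be split into two unions of components, one
    joining [W3] and the other joining [W2] and the rest of [W1] beyond [R]. *)
Lemma card_reach (G : sgraph) (m a : nat) (K W1 W2 W3 X R : {set G}) :
  no_biclique G m -> no_antibiclique G m ->
  9 * m <= 2 * #|G| -> 2 * a <= m.+1 ->
  #|K| + #|W1| + #|W2| + #|W3| = #|G| -> clique K -> [disjoint K & W1] ->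
  [disjoint W1 & W2] -> [disjoint W1 & W3] -> [disjoint W2 & W3] ->
  anticomplete W1 W2 -> anticomplete W1 W3 -> anticomplete W2 W3 ->
  cutoff K W1 X R -> components_le X a ->
  #|W2| + #|W1 :\: (X :|: R)| < m -> #|W3| + #|W1 :\: (X :|: R)| < m ->
  #|K :&: R| < m.
Proof.
move=> noB noA le9 lea cardG clK dK1 d12 d13 d23 a12 a13 a23.
move=> [sX sR dXR clR aX] leXa; set N := W1 :\: (X :|: R) => lt2 lt3.
rewrite ltnNge; apply/negP=> leD.
have ltT : #|K :|: (R :&: W1)| < 2 * m.
  apply: (noB (K :&: R)) => //.
    by apply/subsetP=> x; rewrite !inE => /andP[->].
  move=> x y; rewrite !inE => /andP[xK xR] /orP[yK|/andP[yR _]]; first exact: clK.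
  exact: clR.
rewrite cardsU_disjoint in ltT; last by apply: disjointWr dK1; apply: subsetIr.
have cardW1 : #|W1| = #|R :&: W1| + #|X| + #|N|.
  rewrite -!cardsU_disjoint.
  - apply: eq_card => x; rewrite !inE; have := subsetP sX x.
    by case: (x \in W1); case: (x \in X); case: (x \in R) => //=; case/(_ isT).
  - rewrite -setI_eq0; apply/eqP/setP=> x; rewrite !inE.
    by case: (x \in X); case: (x \in R) => //=; rewrite ?andbF.
  - by rewrite disjoint_sym; apply: disjointWr dXR; apply: subsetIl.
have [ltX|leX] := ltnP (#|X| + #|W3|) m.
  by move: le9 leD cardG lt2 lt3 ltT cardW1 ltX; clear; lia.
(* [P] tops [W3] up to [m] with an overshoot below [a]; the opposite side is then below [m], which
   keeps [#|G|] under [9 * m / 2]. *)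
have [] := @component_grouping _ X a (m - #|W3|) leXa; first by move: leX lt3; clear; lia.
move=> P [C [[/andP[sPX aPX] CX sCP] [leP ltPC leC]]].
have cardP : #|P| = #|P :\: C| + #|C|.
  by rewrite cardsD (setIidPr sCP) subnK // subset_leq_card.
have cardX : #|X| = #|P| + #|X :\: P|.
  by rewrite cardsD (setIidPr sPX) subnKC // subset_leq_card.
have sPW := subset_trans sPX sX.
suff : #|W2 :|: (N :|: (X :\: P))| < m.
  rewrite !cardsU_disjoint.
  - move: le9 lea cardG lt2 lt3 ltT cardW1 leP ltPC leC cardP cardX; clear; lia.
  - rewrite -setI_eq0; apply/eqP/setP=> x; rewrite !inE.
    by case: (x \in X) => //=; rewrite ?andbF.
  - apply: disjointWr (_ : [disjoint W2 & W1]); last by rewrite disjoint_sym.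
  by rewrite subUset subsetDl (subset_trans (subsetDl _ _) sX).
apply: (noA (W3 :|: P)).
- have sNXP : N :|: X :\: P \subset W1.
    by rewrite subUset subsetDl (subset_trans (subsetDl _ _) sX).
  apply: disjoint_setUl.
    apply: disjointWr (_ : [disjoint W3 & W2 :|: W1]); first exact: setUS.
    by rewrite disjoint_sym; apply: disjoint_setUl.
  rewrite disjoint_sym; apply: disjoint_setUl.
    by rewrite disjoint_sym; apply: disjointWl d12.
  rewrite disjoints_subset; apply/subsetP=> x; rewrite !inE.
  by have := subsetP sPX x; case: (x \in P) => //= ->; rewrite // andbF.
- apply: anticompleteUl; apply: anticompleteUr.
  + exact: anticomplete_sym.
  + apply: anticomplete_sym; apply: anticompleteS a13 => //.
    by rewrite subUset subsetDl (subset_trans (subsetDl _ _) sX).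
  + exact: anticompleteS a12.
  + apply: anticompleteUr => //; apply: anticompleteS aX => //.
    by apply/subsetP=> x; rewrite !inE => /andP[].
- rewrite cardsU_disjoint; first by move: leP leX; clear; lia.
  by rewrite disjoint_sym; apply: disjointWl d13.
Qed.

(** A component of [~: K] meeting [X] lies in [X], hence is small; one avoiding [X] is anticomplete
    to [X], which has at least [m] vertices. *)
Lemma balanced_separator (G : sgraph) (m : nat) :
  chordal G -> no_antibiclique G m -> m <= #|G| ->
  exists2 K : {set G}, clique K & components_le (~: K) m.
Proof.
move=> chG noA leG.
have [||||X [K [[_ _ dXK] [clK aX leX leXm]]]] :=
  @clique_separator G setT set0 m chG; rewrite ?cardsT //.
- by move=> x; rewrite inE.
- by rewrite disjoint_sym disjoints_subset sub0set.
- by apply/anticompleteP=> x y _; rewrite !inE.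
exists K => // C CS connC; have /andP[sCS /anticompleteP aCS] := CS.
have [|CX|CX] := connC (C :&: X).
- rewrite /component_union subsetIl; apply/anticompleteP=> x y.
  rewrite !inE => /andP[xC xX] /andP[+ yC]; rewrite yC /= => yNX.
  have := subsetP sCS y yC; rewrite inE => yNK.
  by move/anticompleteP: aX => ->; rewrite // !inE negb_or yNX.
- apply/ltnW/(noA X) => //.
    by rewrite disjoint_sym -setI_eq0 CX.
  apply: anticompleteS aX => //; apply/subsetP=> y yC; rewrite !inE negb_or.
  have := subsetP sCS y yC; rewrite inE => ->; rewrite andbT.
  by apply/negP=> yX; have := in_set0 y; rewrite -CX inE yC yX.
apply: leXm => //; have sCX : C \subset X by rewrite -CX subsetIr.
rewrite /component_union sCX; apply/anticompleteP=> x y xC.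
rewrite inE => /andP[yNC yX]; apply: aCS => //.
by rewrite !inE yNC (disjointFr dXK yX).
Qed.

Lemma chordal_no_biclique (G : sgraph) (m : nat) :
  chordal G -> 0 < m -> 9 * m <= 2 * #|G| ->
  no_biclique G m -> no_antibiclique G m -> False.
Proof.
move=> chG m_gt0 le9 noB noA.
have [||K clK leKm] := @balanced_separator G m chG => //; first by lia.
have ltK : #|K| < 2 * m.
  have [leK|] := leqP m #|K|; last by lia.
  by apply: (noB K K) => // x y; apply: clK.
have cardK := cardsC K; set S := ~: K in leKm cardK.
(* The three groups are [W1], [W2] and [C]: minimality of [A] bounds [W2], and anticompleteness to
   [A] bounds [W1]. *)
have [] := @component_grouping _ S m m leKm; first by lia.
move=> A [C [[AS CS sCA] [leA ltAC leC]]].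
have /andP[sAS aAS] := AS; have /andP[sCS aCS] := CS.
pose W1 := S :\: A; pose W2 := A :\: C.
have cardA : #|A| = #|W2| + #|C|.
  by rewrite cardsD (setIidPr sCA) subnK // subset_leq_card.
have cardS : #|S| = #|W1| + #|A|.
  by rewrite cardsD (setIidPr sAS) subnK // subset_leq_card.
have ltW1 : #|W1| < m.
  apply: (noA A) => //.
  by rewrite disjoint_sym disjoints_subset; apply/subsetP=> x; rewrite !inE => /andP[].
have d12 : [disjoint W1 & W2].
  rewrite disjoints_subset; apply/subsetP=> x; rewrite !inE => /andP[xNA _].
  by rewrite (negPf xNA) andbF.
have d1C : [disjoint W1 & C].
  rewrite disjoints_subset; apply/subsetP=> x; rewrite !inE => /andP[xNA _].
  by apply: contra xNA; apply: (subsetP sCA).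
have d2C : [disjoint W2 & C].
  by rewrite disjoints_subset; apply/subsetP=> x; rewrite !inE => /andP[].
have dKS : [disjoint K & S] by rewrite disjoints_subset /S setCK.
have dK1 : [disjoint K & W1] by apply: disjointWr dKS; apply: subsetDl.
have dKC : [disjoint K & C] by apply: disjointWr dKS.
have dK2 : [disjoint K & W2].
  by apply: disjointWr dKS; apply: subset_trans sAS; apply: subsetDl.
have a1A : anticomplete W1 A by apply: anticomplete_sym.
have a12 : anticomplete W1 W2 by apply: anticompleteS a1A; rewrite ?subsetDl.
have a1C : anticomplete W1 C by apply: anticompleteS a1A.
have a2C : anticomplete W2 C.
  by apply: anticomplete_sym; apply: anticompleteS aCS; rewrite ?setSD.
(* [a] is [m / 2] rounded up: two of the [Xi] together reach [m], while the overshoot stays near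
   [m / 2]. *)
have a2 : exists a, m <= 2 * a <= m.+1 by exists (m.+1 %/ 2); clear; lia.
case: a2 => a /andP[lema leam].
(* [K] and two of the parts have fewer than [4 * m] vertices, so the third has more than [m / 2]. *)
have leaW : [/\ a <= #|W1|, a <= #|W2| & a <= #|C|].
  move: ltK cardK cardA cardS ltW1 ltAC leC le9 lema leam; rewrite -/W2; clear.
  by split; lia.
case: leaW => leaW1 leaW2 leaC.
have cut W : component_union W S -> a <= #|W| ->
    exists X R, [/\ cutoff K W X R, a <= #|X| & components_le X a].
  move=> /andP[sWS aWS] leW.
  have [||X [R [[sX sR dXR] [clR aXR leX leXa]]]] :=
    @clique_separator G W K a chG clK _ _ leW.
  - by rewrite disjoint_sym; apply: disjointWr dKS.
  - apply: anticompleteS aWS => //; apply/subsetP=> x.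
    by rewrite !inE negb_or.
  by exists X, R.
have W1S : component_union W1 S := component_unionD (component_union_refl S) AS.
have W2S : component_union W2 S := component_unionD AS CS.
have [X1 [R1 [cut1 leX1 X1a]]] := cut W1 W1S leaW1.
have [X2 [R2 [cut2 leX2 X2a]]] := cut W2 W2S leaW2.
have [X3 [R3 [cut3 leX3 X3a]]] := cut C CS leaC.
have m_le (x y : nat) : a <= x -> a <= y -> m <= x + y by move: lema; clear; lia.
have d21 : [disjoint W2 & W1] by rewrite disjoint_sym.
have dC1 : [disjoint C & W1] by rewrite disjoint_sym.
have dC2 : [disjoint C & W2] by rewrite disjoint_sym.
have b12 :=
  @card_beyond_two G m K W1 W2 C X1 R1 X2 R2 noA dK1 dK2 dKC d12 d1C d2C cut1 cut2.
have b13 :=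
  @card_beyond_two G m K W1 C W2 X1 R1 X3 R3 noA dK1 dKC dK2 d1C d12 dC2 cut1 cut3.
have b23 :=
  @card_beyond_two G m K W2 C W1 X2 R2 X3 R3 noA dK2 dKC dK1 d2C d21 dC1 cut2 cut3.
have {}b12 := b12 (m_le _ _ leX1 leX2); have {}b13 := b13 (m_le _ _ leX1 leX3).
have {}b23 := b23 (m_le _ _ leX2 leX3).
have cardG : #|K| + #|W1| + #|W2| + #|C| = #|G| by move: cardK cardA cardS; clear; lia.
have r1 : #|K :&: R1| < m.
  apply: (@card_reach G m a K W1 W2 C X1 R1) => //; move: b12 b13; clear; lia.
have r2 : #|K :&: R2| < m.
  apply: (@card_reach G m a K W2 W1 C X2 R2) => //.
  - by move: cardG; clear; lia.
  - exact: anticomplete_sym.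
  - by move: b23; clear; lia.
  - by move: b12; clear; lia.
have r3 : #|K :&: R3| < m.
  apply: (@card_reach G m a K C W1 W2 X3 R3) => //.
  - by move: cardG; clear; lia.
  - exact: anticomplete_sym.
  - exact: anticomplete_sym.
  - by move: b23; clear; lia.
  - by move: b13; clear; lia.
(* The pairwise bounds put each part below [m], so [#|K|] exceeds [3 * m / 2] and [#|K| + #|G|]
   exceeds [6 * m]; added to the double count, they give [#|K| + #|G| < 6 * m]. *)
have := double_count K R1 R2 R3.
by move: r1 r2 r3 b12 b13 b23 cardG le9; clear; lia.
Qed.

Lemma chordal_bipartite (G : sgraph) (m : nat) : chordal G -> 9 * m <= 2 * #|G| ->
  contains_subgraph G (complete_bipartite m m) \/
  contains_subgraph (compl G) (complete_bipartite m m).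
Proof.
move=> chG; have [->|m_gt0] := posnP m => le9.
  by left; apply: (@biclique_contains _ set0 set0) => // x y; rewrite inE.
apply: contrapT => /not_orP[noB noA]; apply: (chordal_no_biclique chG m_gt0 le9).
  move=> D T sDT DT leD; rewrite ltnNge; apply/negP=> leT.
  exact/noB/(dominating_contains sDT leD leT DT).
move=> A B dAB /anticompleteP aAB leA; rewrite ltnNge; apply/negP=> leB.
exact/noA/(compl_contains leA leB dAB aAB).
Qed.

Theorem theorem1p1 :
  (forall (R : realType) (G : sgraph), interval_graph R G ->
     let m := #|G| %/ 4 in
     contains_subgraph G (complete_bipartite m m) \/
     contains_subgraph (compl G) (complete_bipartite m m)) /\
  (forall G : sgraph, cograph G ->
     let m := #|G| %/ 4 in
     contains_subgraph G (complete_bipartite m m) \/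
     contains_subgraph (compl G) (complete_bipartite m m)) /\
  (forall G : sgraph, chordal G ->
     let m := (2 * #|G|) %/ 9 in
     contains_subgraph G (complete_bipartite m m) \/
     contains_subgraph (compl G) (complete_bipartite m m)).
Proof.
split; [|split].
- move=> R G iG /=; apply: (interval_bipartite iG).
  by rewrite mulnC leq_trunc_div.
- move=> G cG /=; apply: (cograph_bipartite cG).
  by rewrite mulnC leq_trunc_div.
- move=> G cG /=; apply: (chordal_bipartite cG).
  by rewrite mulnC leq_trunc_div.
Qed.
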